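(* Let $p:(\mathbb{R}^d\times\mathbb{R}\times\mathbb{R}^d)^2\to\mathbb{R}^\ell$ be a pairwise constraint. If $p$ is an interpolation constraint for $\mathcal{F}^m_p(\mathbb{R}^d)$, then $p$ is pointwise extensible.
   Context: Fix $d\ge 1$. A pairwise constraint is a map $p:(\mathbb{R}^d\times\mathbb{R}\times\mathbb{R}^d)^2\to\mathbb{R}^\ell$, $\ell\geq 1$; inequalities $p(\cdot,\cdot)\ge 0$ are elementwise. For $\mathcal{X}\subseteq\mathbb{R}^d$, a mapping $F=(f,g):\mathcal{X}\rightrightarrows\mathbb{R}\times\mathbb{R}^d$ assigns to each $x\in\mathcal{X}$ the nonempty set $F(x)=\{f(x)\}\times g(x)$, where $f(x)\in\mathbb{R}$ is single-valued and $g(x)\subseteq\mathbb{R}^d$ is nonempty and possibly multi-valued. Any element of $F(x)$ is denoted $F_x$. $\mathrm{Graph}\,F=\{(x,F_x): x\in\mathcal{X},\ F_x\in F(x)\}$. Define $\mathcal{F}_p(\mathcal{X})$ as the set of mappings $F:\mathcal{X}\rightrightarrows\mathbb{R}\times\mathbb{R}^d$ such that $p((x_1,F_{x_1}),(x_2,F_{x_2}))\ge 0$ for all $x_1,x_2\in\mathcal{X}$ and all $F_{x_i}\in F(x_i)$, $i=1,2$. Define $\mathcal{F}^m_p(\mathbb{R}^d)$ as the set of those $F\in\mathcal{F}_p(\mathbb{R}^d)$ for which there is no $\bar F\in\mathcal{F}_p(\mathbb{R}^d)$ with $\mathrm{Graph}\,F\subsetneq\mathrm{Graph}\,\bar F$.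 When $\mathcal{X}$ is finite, mappings $F\in\mathcal{F}_p(\mathcal{X})$ are understood to have finite graph, i.e. they correspond to finite datasets $\{(x_i,f_i,g_i)\}$ (the same $x_i$ may appear with several $g_i$). Interpolation constraint: $p$ is an interpolation constraint for $\mathcal{F}^m_p(\mathbb{R}^d)$ if for every finite $\mathcal{X}\subset\mathbb{R}^d$ and every $F\in\mathcal{F}_p(\mathcal{X})$ there exists $\bar F\in\mathcal{F}^m_p(\mathbb{R}^d)$ such that $F(x)\subseteq\bar F(x)$ for all $x\in\mathcal{X}$. Pointwise extensible: $p$ is pointwise extensible if for every finite $\mathcal{X}\subset\mathbb{R}^d$, every $z\in\mathbb{R}^d$ and every $F\in\mathcal{F}_p(\mathcal{X})$, there exists $\bar F\in\mathcal{F}_p(\mathcal{X}\cup\{z\})$ such that $\bar F(x)=F(x)$ for all $x\in\mathcal{X}$. *)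

(* Defs.v *)
From HB Require Import structures.
From mathcomp Require Import all_boot all_order all_algebra.
From mathcomp Require Import boolp classical_sets functions cardinality reals.

Set Implicit Arguments.
Unset Strict Implicit.
Unset Printing Implicit Defensive.

Import Order.TTheory GRing.Theory Num.Theory.
Local Open Scope classical_set_scope.
Local Open Scope ring_scope.

Section PairwiseConstraints.
Variables (R : realType) (d l : nat).

(* (x, (f, g)): a point, a function value and a (sub)gradient-like vector. *)
Definition datum : Type := ('rV[R]_d * (R * 'rV[R]_d))%type.

Definition pairwise_constraint : Type := datum * datum -> 'rV[R]_l.

(* Set-valued maps into R x R^d are total; one with domain X has empty values
   outside X, so that F is determined by its values on X. *)
Definition setmap : Type := 'rV[R]_d -> set (R * 'rV[R]_d).

Definition graph (F : setmap) : set datum := [set u | F u.1 u.2].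

(* F = (f, g) : X => R x R^d, with f single-valued and g nonempty-valued.
   Over a finite X, mappings are finite datasets: the graph has to be finite,
   although g may still be multi-valued. *)
Definition mapping_on (X : set 'rV[R]_d) (F : setmap) : Prop :=
  [/\ forall x, X x ->
        exists (f : R) (g : set 'rV[R]_d), g !=set0 /\ F x = [set f] `*` g,
      forall x, ~ X x -> F x = set0
    & finite_set X -> finite_set (graph F)].

Definition Fp (p : pairwise_constraint) (X : set 'rV[R]_d) : set setmap :=
  [set F | mapping_on X F /\
    forall x1 x2, X x1 -> X x2 ->
    forall F1 F2, F x1 F1 -> F x2 F2 ->
    forall i, 0 <= p ((x1, F1), (x2, F2)) ord0 i].

Definition Fpm (p : pairwise_constraint) : set setmap :=
  [set F | Fp p setT F /\
    ~ exists Fbar, Fp p setT Fbar /\ graph F `<` graph Fbar].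

Definition interpolation_constraint (p : pairwise_constraint) : Prop :=
  forall X, finite_set X -> forall F, Fp p X F ->
  exists Fbar, Fpm p Fbar /\ forall x, X x -> F x `<=` Fbar x.

Definition pointwise_extensible (p : pairwise_constraint) : Prop :=
  forall X, finite_set X -> forall z F, Fp p X F ->
  exists Fbar, Fp p (X `|` [set z]) Fbar /\ forall x, X x -> Fbar x = F x.

End PairwiseConstraints.

(* Main.v *)
(* An interpolating map on R^d is defined at z; adding any one of its values at
   z to the dataset keeps every pair of data inside the graph of that map. *)
Require Import Defs.
From mathcomp Require Import all_boot all_order all_algebra.
From mathcomp Require Import boolp classical_sets functions cardinality reals.

(** The condition imposed by [p] is pairwise, so it passes to every subset of the graph of a map
    satisfying it. Interpolation supplies such a map [G], total and containing the data; its
    totality provides a value at [z]. *)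

Theorem proposition1 (R : realType) (d l : nat)
    (d_gt0 : (0 < d)%N) (l_gt0 : (0 < l)%N) (p : pairwise_constraint R d l) :
  interpolation_constraint p -> pointwise_extensible p.
Proof.
move=> interp X finX z F FpF.
(* If [z] is already in [X], the extension must agree with [F] there, so [F] itself serves. *)
have [Xz|nXz] := pselect (X z).
  exists F; split=> //.
  suff -> : (X `|` [set z] = X)%classic by [].
  by apply/setUidPl => _ ->.
have [G [[[[Gval _ _] Gp] _] FG]] := interp X finX F FpF.
have [[Fval F0 Ffin] _] := FpF.
have [f [g [[v gv] Gz]]] := Gval z I.
(* Only one [v] is kept: [g] may be infinite, while the graph over a finite domain must be
   finite. *)
pose H : setmap R d := fun x => if x == z then [set (f, v)]%classic else F x.
have HX x : X x -> H x = F x.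
  by move=> Xx; rewrite /H; case: eqP => // xz; case: nXz; rewrite -xz.
have Hz : H z = [set (f, v)]%classic by rewrite /H eqxx.
exists H; split; last exact: HX.
(* This inclusion of [H] in [G] transfers the inequalities, including those between old data and the
   new datum. *)
have HG x y : (X `|` [set z])%classic x -> H x y -> G x y.
  case=> [Xx|->]; first by rewrite HX //; exact: FG.
  by rewrite Hz Gz => ->.
split; last first.
  by move=> x1 x2 X1 X2 F1 F2 H1 H2; apply: Gp => //; exact: HG.
split.
- move=> x [Xx|->]; first by rewrite HX //; exact: Fval.
  exists f, [set v]%classic; split; first by exists v.
  by rewrite Hz; apply/seteqP; split=> [_ -> //|[a b] /= [-> ->]].
- move=> x nXx; rewrite /H; case: eqP => [xz|_].
    by case: nXx; right.
  by apply: F0 => Xx; apply: nXx; left.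
- move=> _; apply: (@sub_finite_set _ _ (graph F `|` [set (z, (f, v))])%classic).
    move=> [x y]; rewrite /graph /= /H; case: eqP => [->|_] Hy; last by left.
    by right; rewrite Hy.
  by rewrite finite_setU; split; [exact: Ffin | exact: finite_set1].
Qed.
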